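(* Let $q=p^n$ be a prime power, where $p$ is a prime and $n$ is an even positive integer. Then there exists a pencil of plane curves $\mathcal{L}=\langle F,G\rangle$ over $\mathbb{F}_q$ with no $\mathbb{F}_q$-points in its base locus such that exactly $\sqrt{q}$ of the $q+1$ $\mathbb{F}_q$-members of $\mathcal{L}$ are nonblocking curves.
   Context: A pencil of plane curves $\mathcal{L}=\langle F,G\rangle$ over $\mathbb{F}_q$ is given by two linearly independent homogeneous polynomials $F,G\in\mathbb{F}_q[x,y,z]$ of the same degree $d\ge 1$ ($d$ is called the degree of the pencil). Its $\mathbb{F}_q$-members are the $q+1$ plane curves $C_{[s:t]}=\{sF+tG=0\}\subset\mathbb{P}^2$ for $[s:t]\in\mathbb{P}^1(\mathbb{F}_q)$. The pencil has no $\mathbb{F}_q$-points in its base locus if there is no $P\in\mathbb{P}^2(\mathbb{F}_q)$ with $F(P)=G(P)=0$. A set $B\subseteq\mathbb{P}^2(\mathbb{F}_q)$ is a blocking set if every $\mathbb{F}_q$-line (line in $\mathbb{P}^2$ defined over $\mathbb{F}_q$) meets $B$, i.e. contains a point of $B$. A plane curve $C$ defined over $\mathbb{F}_q$ is a blocking curve if its set $C(\mathbb{F}_q)$ of $\mathbb{F}_q$-points is a blocking set, and is nonblocking otherwise. *)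

(* Defs.v *)
From HB Require Import structures.
From mathcomp Require Import all_boot all_order all_algebra.
From mathcomp Require Import mpoly.

Set Implicit Arguments.
Unset Strict Implicit.
Unset Printing Implicit Defensive.

Import GRing.Theory.
Local Open Scope ring_scope.

(* The point [v_0 : ... : v_(m-1)] of P^(m-1)(K), as the set of all its
   homogeneous coordinate vectors; meaningful only for v != 0. *)
Definition ppoint (K : finFieldType) (m : nat) (v : 'rV[K]_m) : {set 'rV[K]_m} :=
  [set a *: v | a : K & a != 0].

Definition proj_space (K : finFieldType) (m : nat) : {set {set 'rV[K]_m.+1}} :=
  [set ppoint v | v : 'rV[K]_m.+1 & v != 0].

(* For f homogeneous, the set of K-points of the plane curve f = 0. *)
Definition rat_points (K : finFieldType) (f : {mpoly K[3]}) :
    {set {set 'rV[K]_3}} :=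
  [set ppoint v | v : 'rV[K]_3 & (v != 0) && (f.@[v 0] == 0)].

Definition line (K : finFieldType) (a : 'rV[K]_3) : {set {set 'rV[K]_3}} :=
  [set ppoint v | v : 'rV[K]_3 & (v != 0) && (\sum_i a 0 i * v 0 i == 0)].

Definition blocking_set (K : finFieldType) (B : {set {set 'rV[K]_3}}) : bool :=
  (B \subset proj_space K 2) &&
  [forall a : 'rV[K]_3, (a != 0) ==> (line a :&: B != set0)].

Definition blocking_curve (K : finFieldType) (f : {mpoly K[3]}) : bool :=
  blocking_set (rat_points f).

Definition is_pencil (K : finFieldType) (d : nat) (F G : {mpoly K[3]}) : Prop :=
  [/\ (1 <= d)%N, F \is d.-homog, G \is d.-homog
    & forall a b : K, a *: F + b *: G = 0 -> a = 0 /\ b = 0].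

Definition member (K : finFieldType) (F G : {mpoly K[3]}) (st : 'rV[K]_2) :
    {mpoly K[3]} :=
  st 0 0 *: F + st 0 1 *: G.

Definition no_rat_base_point (K : finFieldType) (F G : {mpoly K[3]}) : Prop :=
  rat_points F :&: rat_points G = set0.

(* Members are counted by their parameter [s : t] in P^1(K); the curve
   s F + t G = 0 does not depend on the representative (s, t). *)
Definition nonblocking_members (K : finFieldType) (F G : {mpoly K[3]}) :
    {set {set 'rV[K]_2}} :=
  [set ppoint st | st : 'rV[K]_2
     & (st != 0) && ~~ blocking_curve (member F G st)].

(* Main.v *)
(* Put r = p ^ (n / 2), so that q = r ^ 2. Since every homogeneous function of
   degree 0 on K^3 \ 0 is given by a form of degree 3 (q - 1), pencils without
   rational base points realise all maps P^2(K) -> P^1(K), the member [s : t]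
   having as points one fibre of the map. Identify P^2(K) with E^* / K^*, where
   E is the cubic extension of K. The cosets of K^* L^* in E^*, L being the
   subfield of order r ^ 3, are r ^ 2 - r + 1 disjoint Baer subplanes, and each
   is a blocking set: a K-linear form on the r ^ 3 elements of e L takes only
   r ^ 2 values. A map that is constant on each of these subplanes, with
   distinct values, leaves q + 1 - (r ^ 2 - r + 1) = r fibres empty. *)
Require Import Defs.
From mathcomp Require Import all_boot all_order all_algebra all_fingroup all_field.
From mathcomp Require Import mpoly zify.

Set Implicit Arguments.
Unset Strict Implicit.
Unset Printing Implicit Defensive.

Import GRing.Theory.
Local Open Scope ring_scope.

(** * Interpolation by forms on projective space over a finite field *)

Lemma expf_card_pred (K : finFieldType) (x : K) : x ^+ #|K|.-1 = (x != 0)%:R.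
Proof.
have K1 := finNzRing_gt1 K; have [->|x0] := eqVneq x 0.
  by rewrite expr0n -(subnKC K1).
apply: (mulfI x0); rewrite -exprS prednK ?expf_card ?mulr1 //.
exact: ltn_trans K1.
Qed.

Lemma natr_card0 (K : finFieldType) : #|K|%:R = 0 :> K.
Proof.
have [p p_pr pK] := finPcharP K.
rewrite (card_pprimeChar pK) natrX pcharf0 // expr0n.
have : (1 < p ^ logn p #|K|)%N by rewrite -(card_pprimeChar pK) finNzRing_gt1.
by case: (logn p _).
Qed.

Lemma ppointP (K : finFieldType) m (v w : 'rV[K]_m) :
  reflect (exists2 a, a != 0 & w = a *: v) (w \in ppoint v).
Proof.
by apply: (iffP imsetP) => -[a]; rewrite ?inE => a0 ->; exists a; rewrite ?inE.
Qed.

Lemma ppoint_sym (K : finFieldType) m (v w : 'rV[K]_m) :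
  (w \in ppoint v) = (v \in ppoint w).
Proof.
by apply/ppointP/ppointP => -[a a0 ->]; exists a^-1;
  rewrite ?invr_eq0 // scalerA mulVf // scale1r.
Qed.

Lemma ppoint_id (K : finFieldType) m (v : 'rV[K]_m) : v \in ppoint v.
Proof. by apply/ppointP; exists 1; rewrite ?oner_eq0 ?scale1r. Qed.

(** Vanishing of a linear form y is detected by 1 - y ^ (q - 1). Replacing 1 by the (q - 1)-th power
    of a coordinate that is nonzero at [P] makes this homogeneous. *)
Lemma ppoint_indicator (K : finFieldType) m (P : 'rV[K]_m) : P != 0 ->
  exists2 f : {mpoly K[m]}, f \is (#|K|.-1 * m).-homog
    & forall v : 'rV_m, f.@[v 0] = (v \in ppoint P)%:R.
Proof.
case/rV0Pn => i Pi.
(* If v_i != 0, the j-th factor is 1 when P_i v_j = P_j v_i and 0 otherwise;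
   if v_i = 0, the i-th factor is 0. *)
pose f := \prod_(j < m) ('X_i ^+ #|K|.-1
                         - (P 0 i *: 'X_j - P 0 j *: 'X_i) ^+ #|K|.-1) : {mpoly K[m]}.
have X1 j : ('X_j : {mpoly K[m]}) \is 1.-homog by rewrite dhomogX /= mdeg1.
exists f => [|v].
  have -> : (#|K|.-1 * m = \sum_(j < m) #|K|.-1)%N.
    by rewrite sum_nat_const card_ord mulnC.
  rewrite /f; elim/big_rec2: _ => [|j g d _ gd]; first exact: dhomog1.
  have Xn g' : g' \is 1.-homog -> g' ^+ #|K|.-1 \is (#|K|.-1).-homog.
    by move=> /dhomogMn -/(_ #|K|.-1); rewrite mul1n.
  by rewrite dhomogM // rpredB // Xn // rpredB // dhomogZ.
rewrite rmorph_prod /=.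
under eq_bigr => j _ do
  rewrite mevalB !rmorphXn /= mevalB !mevalZ !mevalXU !expf_card_pred.
case: ppointP => [[a a0 ->]|nPv].
  apply: big1 => j _; rewrite !mxE mulf_eq0 (negPf a0) (negPf Pi) /=.
  by rewrite mulrCA [P 0 j * (a * _)]mulrCA [P 0 j * _]mulrC subrr eqxx subr0.
apply/eqP; rewrite prodf_seq_eq0; apply/hasPn => nz.
have {}nz j := nz j (mem_index_enum j).
have vi : v 0 i != 0.
  have := nz i; rewrite subrr eqxx subr0.
  by case: (v 0 i == 0); rewrite ?eqxx.
apply: nPv; exists (v 0 i / P 0 i); first by rewrite mulf_neq0 ?invr_eq0.
apply/rowP => j; rewrite !mxE; apply: (mulfI Pi).
have /= := nz j; rewrite vi subr_eq0 [P 0 i * (_ * _)]mulrCA mulrA divfK //.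
case: (P 0 i * v 0 j - _ =P 0); last by rewrite eqxx.
by move/subr0_eq ->; rewrite mulrC.
Qed.

(** A combination of point indicators, weighted by [h]. The degree is the same for all [h], so two
    interpolating forms can generate one pencil. *)
Lemma homog_interpolation (K : finFieldType) m (h : 'rV[K]_m -> K) :
    (forall a v, a != 0 -> h (a *: v) = h v) ->
  exists2 f : {mpoly K[m]}, f \is (#|K|.-1 * m).-homog
    & forall v : 'rV_m, v != 0 -> f.@[v 0] = h v.
Proof.
move=> hZ.
have /fin_all_exists2 [e e_hom eE] (P : 'rV[K]_m) :
  exists2 f : {mpoly K[m]}, f \is (#|K|.-1 * m).-homog
    & P != 0 -> forall v : 'rV_m, f.@[v 0] = (v \in ppoint P)%:R.
  case: (eqVneq P 0) => [_|/ppoint_indicator [f fd fE]]; last by exists f.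
  by exists 0; rewrite ?rpred0.
(* The sum runs over vectors, hence counts every point q - 1 = -1 times. *)
exists (- \sum_(P | P != 0) h P *: e P) => [|v v0].
  by rewrite rpredN rpred_sum // => P _; rewrite dhomogZ.
rewrite mevalN (big_morph _ (mevalD _) (meval0 _)).

under eq_bigr => P P0 do rewrite mevalZ eE // ppoint_sym mulr_natr mulrb.
rewrite -big_mkcondr /= (eq_bigl (fun P => P \in ppoint v)); last first.
  move=> P; rewrite andb_idl // => /ppointP [a a0 ->].
  by rewrite scaler_eq0 (negPf a0).
rewrite big_imset /=; last first.
  move=> a b _ _ /eqP; rewrite -subr_eq0 -scalerBl scaler_eq0.
  by rewrite (negPf v0) orbF subr_eq0 => /eqP.
rewrite (eq_bigr (fun=> h v)) => [|a]; last by rewrite inE => a0; apply: hZ.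
rewrite sumr_const (_ : #|_| = #|K|.-1); last first.
  by rewrite -(cardC1 (0 : K)); apply: eq_card => a; rewrite !inE.
rewrite -subn1 mulrnBr; last exact: ltnW (finNzRing_gt1 K).
by rewrite -mulr_natr natr_card0 mulr0 sub0r opprK.
Qed.

(** * The cubic extension and its colouring by Baer subplanes *)

(** Let [L] be the splitting field of X ^ m - X. Its roots are the fixed points of the [k]-th power
    of Frobenius, hence form a subfield, hence fill [L]; the derivative is -1, so there are exactly
    [m] of them. *)
Lemma finField_extension (F : finFieldType) k : (0 < k)%N ->
  exists L : splittingFieldType F, \dim {:L} = k.
Proof.
move=> k0; set m := (#|F| ^ k)%N.
have m1 : (1 < m)%N by rewrite -(exp1n k) ltn_exp2r // finNzRing_gt1.
have szq (R : nzRingType) : size ('X^m - 'X : {poly R}) = m.+1.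
  by rewrite size_polyDl ?size_polyN size_polyXn ?size_polyX.
have /FinSplittingFieldFor [L] : 'X^m - 'X != 0 :> {poly F}.
  by rewrite -size_poly_eq0 szq.
rewrite rmorphB rmorphXn /= map_polyX => -[zs Dq defL]; exists L.
have m_eq0 : m%:R = 0 :> L.
  rewrite /m natrX -(rmorph_nat (in_alg L)) natr_card0 rmorph0 expr0n.
  by case: (k) k0.
have zs_uniq : uniq zs.
  rewrite -separable_prod_XsubC -(eqp_separable Dq) unlock.
  rewrite derivB derivXn derivX -[_ *+ m]mulr_natr -polyC_natr m_eq0 mulr0 sub0r.
  by rewrite -[- 1]scaleN1r coprimepZr ?coprimep1 // oppr_eq0 oner_eq0.
have [a _ aE] := finField_galois_generator (sub1v {:L}%AS).
have {}aE x : (a ^+ k)%g x = x ^+ m.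
  rewrite /m; elim: (k) => [|i IHi]; first by rewrite gal_id.
  by rewrite expgSr expnSr exprM galM ?memvf // IHi aE ?memvf // dimv1 expn1.
have zsE z : (z \in zs) = ((a ^+ k)%g z == z).
  by rewrite -root_prod_XsubC -(eqp_root Dq) /root !hornerE subr_eq0 aE.
pose E := fixedSpace (a ^+ k)%g.
have zs_all x : x \in zs.
  have : ({:L} <= E)%VS.
    rewrite -defL -[E]subfield_closed agenvS // subv_add sub1v.
    by apply/span_subvP => z; rewrite zsE => /eqP za; apply/fixedSpaceP.
  by move=> /subvP/(_ x (memvf x))/fixedSpaceP ax; rewrite zsE ax.
pose fL := FinFieldExtType L.
have cardL : #|fL| = m.
  have <- : size zs = m.
    apply: succn_inj; rewrite -(size_prod_XsubC _ id) -(eqp_size Dq).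
    exact: szq.
  rewrite -(card_uniqP (zs_uniq : @uniq fL zs)).
  by apply: eq_card => x; rewrite zs_all.
apply/eqP; rewrite -(eqn_exp2l _ _ (finNzRing_gt1 F)) -/m -cardL.
have := card_vspace (T := finvect_type L) (fullv : {vspace finvect_type L}).
by rewrite card_vspacef => ->.
Qed.

Lemma finField_primitive_root (E : finFieldType) :
  exists g : E, #|E|.-1.-primitive_root g.
Proof.
pose rs := [seq x <- enum E | x != 0].
have : has #|E|.-1.-primitive_root rs.
  apply: cyclic.has_prim_root.
  - by rewrite -subn1 subn_gt0 finNzRing_gt1.
  - apply/allP => x; rewrite mem_filter => /andP[x0 _].
    by apply/unity_rootP; rewrite expf_card_pred x0.
  - by rewrite filter_uniq // enum_uniq.
  - by rewrite -(cardC1 (0 : E)) cardE /rs enumT.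
by move=> /hasP[g _ gE]; exists g.
Qed.

(* The colour of x = g ^+ j, g a generator of E^*, is j mod r ^ 2 - r + 1; the
   set A is the translate of the subfield of order r ^ 3 by g ^+ i. *)
Lemma baer_colouring_field (E : finFieldType) p k (r := (p ^ k)%N) :
    prime p -> (0 < k)%N -> #|E| = (r ^ 6)%N ->
  exists l : E -> 'I_(r * r.-1).+1,
    (forall x y, x != 0 -> x ^+ (r ^ 2) = x -> l (x * y) = l y) /\
    forall i, exists A : {set E},
      [/\ {in A &, forall x y, x - y \in A}, (r ^ 2 < #|A|)%N
        & {in A, forall x, x != 0 -> l x = i}].
Proof.
move=> p_pr k0 cardE.
have pE : p \in [pchar E].
  by apply: (@card_finPcharP _ _ (k * 6)); rewrite // expnM.
have r1 : (1 < r)%N by rewrite -(exp1n k) ltn_exp2r // prime_gt1.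
have r_pnat : [pchar E].-nat r.
  by rewrite pnatX; apply/orP; left; rewrite pnatE.
clearbody r; case: r r1 cardE r_pnat => [//|s] s0 cardE r_pnat /=.
(* With r = s + 1, the factors are s (s + 2) = r ^ 2 - 1, s ^ 2 + 3 s + 3 = r ^ 2 + r + 1 and [d] =
   r ^ 2 - r + 1. Thus [W] = r ^ 3 - 1, [V] = r ^ 3 + 1 and [N] = r ^ 6 - 1. *)
set d := (s.+1 * s).+1.
pose N := ((s * (s + 2)) * ((s ^ 2 + 3 * s + 3) * d))%N.
pose W := (s * (s ^ 2 + 3 * s + 3))%N; pose V := ((s + 2) * d)%N.
have N_WV : N = (W * V)%N by rewrite /N /W /V; lia.
have W0 : (0 < W)%N by rewrite /W; lia.
have V0 : (0 < V)%N by rewrite /V; lia.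
have r3 : (s.+1 ^ 3)%N = W.+1 by rewrite /W !expnS; lia.
have r2 : (s.+1 ^ 2)%N = (s * (s + 2)).+1 by rewrite !expnS; lia.
have r2W : (s.+1 ^ 2 < W)%N by rewrite r2 /W !expnS; nia.
have {}cardE : #|E|.-1 = N.
  by rewrite cardE (expnM _ 3 2) r3 N_WV /W /V /d !expnS; lia.
have [g] := finField_primitive_root E; rewrite cardE => gP.
have g0 : g != 0.
  apply/eqP => g0; have := prim_expr_order gP; rewrite g0 expr0n N_WV.
  by rewrite muln_eq0 !gtn_eqF //= => /eqP; rewrite eq_sym oner_eq0.
have gX (x : E) : x != 0 -> {i : nat | x = g ^+ i}.
  move=> x0; have /(prim_rootP gP) [i ->] : x ^+ N = 1; last by exists i.
  by rewrite -cardE expf_card_pred x0.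
(* Only 0 has no logarithm; it gets colour 0 by default. *)
pose l (x : E) := inord ((if [pick i : 'I_N | x == g ^+ i] is Some i then i : nat
                    else 0%N) %% d) : 'I_d.
have N0 : (0 < N)%N by rewrite N_WV muln_gt0 W0.
have lE j : l (g ^+ j) = inord (j %% d).
  rewrite /l; case: pickP => [i|/(_ (Ordinal (ltn_pmod j N0)))]; last first.
    by rewrite /= (prim_expr_mod gP) eqxx.
  rewrite (eq_prim_root_expr gP) => /eqP jiN; congr inord.
  have dN : (d %| N)%N by rewrite /N mulnA dvdn_mull.
  by rewrite -(modn_dvdm j dN) jiN modn_dvdm.
have lD i j : (d %| i)%N -> l (g ^+ (i + j)) = l (g ^+ j).
  by move=> /dvdnP[c ->]; rewrite !lE modnMDl.
have fixX n (x : E) : x != 0 -> x ^+ n.+1 = x -> x ^+ n = 1.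
  by move=> x0 xn; apply: (mulfI x0); rewrite -exprS xn mulr1.
exists l; split=> [x y x0|i].
  (* The order of x divides r ^ 2 - 1, so its logarithm is a multiple of (r ^ 2 + r + 1) [d], and
     multiplying by x preserves colours. *)
  rewrite r2 => /(fixX _ _ x0); have [a ->] := gX _ x0; rewrite -exprM => /eqP.
  rewrite -(prim_order_dvd gP) mulnC /N dvdn_pmul2l; last by lia.
  move=> /(dvdn_trans (dvdn_mull _ (dvdnn d))) da.
  have [->|/gX [b ->]] := eqVneq y 0; first by rewrite mulr0.
  by rewrite -exprD lD.
have gi0 : g ^+ i != 0 by rewrite expf_neq0.
exists [set x | (x / g ^+ i) ^+ (s.+1 ^ 3) == x / g ^+ i]; split.
- move=> x y; rewrite !inE mulrBl => /eqP xE /eqP yE; apply/eqP.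
  apply: (addIr (y / g ^+ i)); rewrite -[X in _ + X = _]yE -exprDn_pchar ?subrK //.
  by rewrite pnatX r_pnat.
(* The powers of g ^ [V] are the [W] nonzero elements of the subfield; their translates already
   outnumber r ^ 2. *)
- apply: leq_trans r2W _; pose f (j : 'I_W) := g ^+ i * g ^+ (j * V).
  have f_inj : injective f.
    move=> j1 j2 /(mulfI gi0) /eqP; rewrite (eq_prim_root_expr gP).
    by rewrite N_WV !modn_small ?ltn_pmul2r // eqn_pmul2r // => /eqP /val_inj.
  rewrite -[leqLHS]card_ord -(card_imset _ f_inj); apply/subset_leq_card/subsetP.
  move=> _ /imsetP[j _ ->]; rewrite inE /f [g ^+ i * _]mulrC mulfK // r3 exprS.
  rewrite -[X in _ * X]exprM (_ : _ * V * W = j * N)%N; last by rewrite N_WV; lia.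
  by rewrite [(j * N)%N]mulnC (exprM g N) (prim_expr_order gP) expr1n mulr1.
(* The logarithm of a nonzero element of the subfield is a multiple of [V], hence of [d]. *)
- move=> x; rewrite inE r3 => /eqP xE x0.
  have y0 : x / g ^+ i != 0 by rewrite mulf_neq0 ?invr_eq0.
  have := fixX _ _ y0 xE; have [a ya] := gX _ y0; rewrite ya -exprM => /eqP.
  rewrite -(prim_order_dvd gP) N_WV mulnC dvdn_pmul2r //.
  move=> /(dvdn_trans (dvdn_mull _ (dvdnn d))) da.
  rewrite -(divfK gi0 x) ya -exprD lD // lE modn_small ?ltn_ord //.
  exact: inord_val.
Qed.

(** The colouring of the field is carried to K ^ 3 by coordinates in a basis. Here [L] is the cubic
    extension of [K], not its subfield of order r ^ 3. *)
Lemma baer_colouring (K : finFieldType) p k (r := (p ^ k)%N) :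
    prime p -> (0 < k)%N -> #|K| = (r ^ 2)%N ->
  exists c : 'rV[K]_3 -> 'I_(r * r.-1).+1,
    (forall a v, a != 0 -> c (a *: v) = c v) /\
    forall i (u : 'rV[K]_3),
      exists v : 'rV[K]_3, [/\ v != 0, \sum_j u 0 j * v 0 j = 0 & c v = i].
Proof.
move=> p_pr k0 cardK; have [L dimL] := finField_extension K (isT : (0 < 3)%N).
have [b b_basis] : exists b : 3.-tuple L, basis_of {:L} b.
  by rewrite -dimL; exists (vbasis {:L}); apply: vbasisP.
have cardL : #|FinFieldExtType L| = (r ^ 6)%N.
  have := card_vspace (T := finvect_type L) (fullv : {vspace finvect_type L}).
  by rewrite card_vspacef [\dim _]dimL cardK -expnM => <-.
have [l [lM l_blocking]] := baer_colouring_field p_pr k0 cardL.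
pose toL (v : 'rV[K]_3) : L := \sum_i v 0 i *: b`_i.
exists (fun v => l (toL v)); split=> [a v a0|i u].
  have -> : toL (a *: v) = a%:A * toL v.
    rewrite mulr_algl /toL scaler_sumr; apply: eq_bigr => i _.
    by rewrite mxE scalerA.
  apply: lM; first by rewrite scaler_eq0 (negPf a0) oner_eq0.
  by rewrite -cardK -(rmorphXn (in_alg L)) expf_card.
have [A [AB ltA lA]] := l_blocking i.
pose f (x : FinFieldExtType L) : K := \sum_j u 0 j * coord b j x.
(* Pigeonhole: [A] has more elements than [K], so the form [f] repeats a value on [A]. The
   difference of the two elements is nonzero, lies in [A] and is killed by [f]. *)
have [x [y [xA yA xy fxy]]] : exists x y, [/\ x \in A, y \in A, x != y & f x = f y].
  have : ~~ dinjectiveb f A.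
    apply: contraL ltA => /dinjectiveP f_inj; rewrite -leqNgt -cardK.
    exact: leq_card_in f_inj.
  by move=> /dinjectivePn[x xA [y /andP[yx yA] fxy]]; exists x, y; rewrite eq_sym.
pose v : 'rV[K]_3 := \row_j coord b j (x - y).
have toLv : toL v = x - y.
  rewrite [RHS](coord_basis b_basis) ?memvf //.
  by apply: eq_bigr => j _; rewrite mxE.
exists v; split; last by rewrite toLv lA ?AB // subr_eq0.
  apply: contraNneq xy => v0; rewrite -subr_eq0 -toLv v0 /toL.
  by rewrite big1 // => j _; rewrite mxE scale0r.
transitivity (f x - f y); last by rewrite fxy subrr.
rewrite -sumrB; apply: eq_bigr => j _.
by rewrite mxE linearB mulrBr.
Qed.

(** * From a colouring to a pencil *)

Lemma ppointZ (K : finFieldType) m (a : K) (v : 'rV[K]_m) :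
  a != 0 -> ppoint (a *: v) = ppoint v.
Proof.
move=> a0; apply/setP => w; apply/ppointP/ppointP => -[c c0 ->].
  by exists (c * a); rewrite ?mulf_neq0 // scalerA.
by exists (c / a); rewrite ?mulf_neq0 ?invr_eq0 // scalerA divfK.
Qed.

Lemma rowP2 (T : Type) (v w : 'rV[T]_2) : v 0 0 = w 0 0 -> v 0 1 = w 0 1 -> v = w.
Proof.
move=> v0 v1; apply/rowP => -[[|[|//]] lt_j].
  by rewrite (_ : Ordinal lt_j = 0) //; apply: val_inj.
by rewrite (_ : Ordinal lt_j = 1) //; apply: val_inj.
Qed.

(** Take G = 1 and F = - [t] ([c] v) as functions on points, where [t] embeds the colours in [K].
    Then G has no rational zero, so there is no rational base point. A member is either a colour
    class, which meets every line, or has no rational points. *)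
Lemma colouring_pencil (K : finFieldType) k (c : 'rV[K]_3 -> 'I_k.+1) :
    (0 < k < #|K|)%N -> (forall a v, a != 0 -> c (a *: v) = c v) ->
    (forall i (u : 'rV[K]_3),
       exists v : 'rV[K]_3, [/\ v != 0, \sum_j u 0 j * v 0 j = 0 & c v = i]) ->
  exists d (F G : {mpoly K[3]}), [/\ is_pencil d F G, no_rat_base_point F G
    & #|nonblocking_members F G| = (#|K| - k)%N].
Proof.
move=> /andP[k0 ltkK] cZ c_blocking.
(* The member [s : t'] vanishes at v iff t' = s * t (c v), so the blocking members
   are the [1 : t i]. *)
pose t (i : 'I_k.+1) : K := enum_val (widen_ord ltkK i).
have t_inj : injective t.
  by move=> i j /enum_val_inj [ij]; apply: val_inj.
have [|F F_hom FE] := @homog_interpolation K 3 (fun v => - t (c v)).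
  by move=> a v /cZ ->.
have [G G_hom GE] := @homog_interpolation K 3 (fun=> 1) (fun _ _ _ => erefl _).
have memberE st (v : 'rV[K]_3) : v != 0 ->
    (member F G st).@[v 0] = st 0 1 - st 0 0 * t (c v).
  by move=> v0; rewrite mevalD !mevalZ FE // GE // mulr1 mulrN addrC.
exists (#|K|.-1 * 3)%N, F, G; split.
- split=> // [|x y xy0].
    by rewrite muln_gt0 andbT -subn1 subn_gt0 finNzRing_gt1.
  have xyE i : y = x * t i.
    (* With the zero form, the hypothesis says that every colour occurs. Two distinct colours then
       force x = 0. *)
    have [v [v0 _ <-]] := c_blocking i 0.
    have := congr1 (fun f => f.@[v 0]) xy0.
    by rewrite mevalD !mevalZ FE // GE // meval0 mulr1 mulrN addrC => /subr0_eq.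
  have x0 : x = 0.
    apply: contraTeq k0 => x0; have := xyE ord_max; rewrite (xyE ord0).
    by move=> /(mulfI x0)/t_inj/(congr1 val) /= <-.
  by rewrite (xyE ord0) x0 mul0r.
- apply/setP => P; rewrite !inE; apply/negP => /andP[_].
  case/imsetP => v; rewrite inE => /andP[v0]; rewrite GE //.
  by rewrite oner_eq0.
have blockingE st : blocking_curve (member F G st) =
    [exists i, st 0 1 == st 0 0 * t i].
  (* Any line will do here: one rational point on the member reveals its colour. *)
  apply/andP/existsP => [[_ /forallP/(_ (const_mx 1))]|[i sti]].
    rewrite (_ : const_mx 1 != 0) /=; last first.
      by apply/rV0Pn; exists 0; rewrite mxE oner_eq0.
    case/set0Pn => P /setIP[_ /imsetP[v]]; rewrite inE => /andP[v0].
    by rewrite memberE // subr_eq0 => stv _; exists (c v).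
  split.
    apply/subsetP => _ /imsetP[v + ->]; rewrite inE => /andP[v0 _].
    by apply: imset_f; rewrite inE.
  apply/forallP => u; apply/implyP => _; have [v [v0 uv ci]] := c_blocking i u.
  apply/set0Pn; exists (ppoint v); rewrite inE; apply/andP; split;
    apply: imset_f; rewrite inE v0 ?uv ?eqxx //=.
  by rewrite memberE // ci subr_eq0.
(* P^1(K) as the affine line with a point at infinity: q + 1 members, of which the k + 1 colours
   account for the blocking ones. *)
pose rep (o : option K) : 'rV[K]_2 :=
  if o is Some a then \row_j (if j == 0 then 1 else a) else \row_j (j != 0)%:R.
have rep_neq0 o : rep o != 0.
  case: o => [a|]; apply/rV0Pn; [exists 0 | exists 1];
  by rewrite mxE /= oner_eq0.
have rep_inj : injective (fun o => ppoint (rep o)).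
  move=> o1 o2 eq_o.
  have /ppointP[a a0 /rowP eq_rep] : rep o1 \in ppoint (rep o2).
    by rewrite -eq_o ppoint_id.
  have := eq_rep 0; have := eq_rep 1; case: o1 o2 {eq_o eq_rep} => [x|] [y|] //=;
    rewrite !mxE /=.
  - by move=> -> eq_a; rewrite mulr1 in eq_a; rewrite -eq_a mul1r.
  - by move=> _ /eqP; rewrite mulr0 oner_eq0.
  - by move=> _ /eqP; rewrite mulr1 eq_sym (negPf a0).
have -> : nonblocking_members F G =
    [set ppoint (rep o) | o in ~: [set Some (t i) | i : 'I_k.+1]].
  apply/setP => P; apply/imsetP/imsetP => -[].
    move=> st; rewrite inE blockingE => /andP[st0 /existsPn st_nb] ->.
    have [s0|s0] := eqVneq (st 0 0) 0.
      exists None; first by rewrite inE; apply/negP => /imsetP[].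
      have y0 : st 0 1 != 0.
        by apply: contraNneq st0 => y0; apply/eqP/rowP2; rewrite ?s0 ?y0 mxE.
      rewrite -(ppointZ (rep None) y0); congr ppoint.
      by apply: rowP2; rewrite !mxE /= ?mulr0 ?mulr1.
    exists (Some (st 0 1 / st 0 0)).
      rewrite inE; apply/negP => /imsetP[i _ [eq_t]].
      by have := st_nb i; rewrite -eq_t mulrCA divff // mulr1 eqxx.
    rewrite -(ppointZ (rep (Some _)) s0); congr ppoint.
    by apply: rowP2; rewrite !mxE /= ?mulr1 // mulrCA divff // mulr1.
  move=> o; rewrite inE => o_nt ->; exists (rep o) => //.
  rewrite inE rep_neq0 blockingE; apply/existsPn => i.
  case: o o_nt => [a|_]; rewrite !mxE /= ?mul0r ?oner_eq0 // mul1r.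
  by apply: contra => /eqP ->; apply: imset_f.
rewrite card_imset // cardsCs setCK card_option card_imset ?card_ord ?subSS //.
by move=> i j [/t_inj].
Qed.

Theorem theorem1p3 (p n q : nat) (K : finFieldType)
  (hp : prime p) (hn : (0 < n)%N) (hn_even : ~~ odd n)
  (hq : q = (p ^ n)%N) (hK : #|K| = q) :
  exists (d : nat) (F G : {mpoly K[3]}),
    [/\ is_pencil d F G,
        no_rat_base_point F G
      & #|nonblocking_members F G| = (p ^ n./2)%N].
Proof.
set r := (p ^ n./2)%N; have n2 : (0 < n./2)%N by case: n hn hn_even {hq r} => [|[]].
have cardK : #|K| = (r ^ 2)%N.
  by rewrite hK hq -expnM muln2 halfK (negPf hn_even) subn0.
have r1 : (1 < r)%N by rewrite -(exp1n n./2) ltn_exp2r // prime_gt1.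
have r_bounds : (0 < r * r.-1 < r ^ 2)%N.
  by case: (r) r1 => [|[|m]] // _; rewrite muln_gt0 -mulnn ltn_pmul2l /=.
have [c [cZ c_blocking]] := baer_colouring hp n2 cardK.
(* There are r (r - 1) + 1 colours, so k = r (r - 1) and q - k = r. *)
have -> : r = (#|K| - r * r.-1)%N.
  by rewrite cardK expnS expn1 -mulnBr -subn1 subKn ?muln1 // ltnW.
apply: colouring_pencil cZ c_blocking.
by rewrite cardK.
Qed.
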